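(* Let $m\ge1$ be an integer. For all $p,q\in\mathcal P_{2m}^E$, $$\mathbf Q_m(p\boxplus_{2m}q)=\mathbf Q_m(p)\boxplus_m^{-1/2}\mathbf Q_m(q).$$
   Context: $\mathcal P_n$ is the set of monic polynomials of degree $n$ over $\mathbb C$. For $p\in\mathcal P_n$ the coefficients $\mathsf e_k(p)$ are defined by $p(x)=\sum_{k=0}^n x^{n-k}(-1)^k\mathsf e_k(p)$. $\mathcal P_{2m}^E$ is the set of $p\in\mathcal P_{2m}$ that are even, i.e. $p(-x)=p(x)$. The falling factorial is $(a)^{\underline k}=a(a-1)\cdots(a-k+1)$. The finite free additive convolution of $p,q\in\mathcal P_n$ is the polynomial $p\boxplus_n q\in\mathcal P_n$ with $\mathsf e_k(p\boxplus_n q)=(n)^{\underline k}\sum_{i+j=k}\frac{\mathsf e_i(p)\mathsf e_j(q)}{(n)^{\underline i}(n)^{\underline j}}$ for $0\le k\le n$. The map $\mathbf Q_m:\mathcal P_{2m}\to\mathcal P_m$ is defined by $\mathsf e_k(\mathbf Q_m(p))=(-1)^k\mathsf e_{2k}(p)$ for $0\le k\le m$ (so $p(x)=\mathbf Q_m(p)(x^2)$ when $p$ is even). Generalized rectangular convolution: for $\alpha\in\mathbb R\setminus\{-1,\dots,-m\}$ and $p,q\in\mathcal P_m$, $p\boxplus_m^\alpha q\in\mathcal P_m$ is the polynomial with $$\mathsf e_k(p\boxplus_m^\alpha q)=(m)^{\underline k}(m+\alpha)^{\underline k}\sum_{i+j=k}\frac{\mathsf e_i(p)}{(m)^{\underline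 i}(m+\alpha)^{\underline i}}\,\frac{\mathsf e_j(q)}{(m)^{\underline j}(m+\alpha)^{\underline j}}\quad(0\le k\le m).$$ *)

(* Defs.v *)
From mathcomp Require Import all_boot all_order all_algebra.
From mathcomp Require Import reals complex.

Set Implicit Arguments.
Unset Strict Implicit.
Unset Printing Implicit Defensive.

Import Order.TTheory GRing.Theory Num.Theory.

Local Open Scope ring_scope.
Local Open Scope complex_scope.

(* The complex numbers are [R[i]] for [R : realType]. *)

Definition in_P (R : realType) (n : nat) (p : {poly R[i]}) : Prop :=
  p \is monic /\ size p = n.+1.

Definition in_PE (R : realType) (n : nat) (p : {poly R[i]}) : Prop :=
  in_P n p /\ (forall x : R[i], p.[- x] = p.[x]).

(* For [k <= n], [ecoef n p k] is e_k(p), i.e. the scalar determined by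
   p = \sum_(k <= n) (-1)^k e_k(p) 'X^(n - k); see [ecoef_expansion].
   It depends on the ambient degree [n], and is only meaningful for [k <= n]
   (the subtraction [n - k] is truncated). *)
Definition ecoef (R : realType) (n : nat) (p : {poly R[i]}) (k : nat) : R[i] :=
  (-1) ^+ k * p`_(n - k).

Definition poly_of_ecoef (R : realType) (n : nat) (e : nat -> R[i]) :
    {poly R[i]} :=
  \sum_(k < n.+1) ((-1) ^+ k * e k) *: 'X^(n - k).

Definition ffactc (R : realType) (a : R[i]) (k : nat) : R[i] :=
  \prod_(j < k) (a - j%:R).

Definition fconv (R : realType) (n : nat) (p q : {poly R[i]}) : {poly R[i]} :=
  poly_of_ecoef n (fun k =>
    ffactc n%:R k *
    \sum_(i < k.+1)
      (ecoef n p i * ecoef n q (k - i)) /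
      (ffactc n%:R i * ffactc n%:R (k - i))).

Definition Qmap (R : realType) (m : nat) (p : {poly R[i]}) : {poly R[i]} :=
  poly_of_ecoef m (fun k => (-1) ^+ k * ecoef (2 * m) p (2 * k)).

(* Meaningful for [alpha] outside {-1, ..., -m}, where no denominator
   vanishes. *)
Definition rconv (R : realType) (m : nat) (alpha : R) (p q : {poly R[i]}) :
    {poly R[i]} :=
  poly_of_ecoef m (fun k =>
    ffactc m%:R k * ffactc (m%:R + alpha%:C) k *
    \sum_(i < k.+1)
      (ecoef m p i / (ffactc m%:R i * ffactc (m%:R + alpha%:C) i)) *
      (ecoef m q (k - i) /
        (ffactc m%:R (k - i) * ffactc (m%:R + alpha%:C) (k - i)))).

Lemma coef_poly_of_ecoef (R : realType) (n : nat) (e : nat -> R[i]) (k : nat) :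
  (k <= n)%N -> (poly_of_ecoef n e)`_(n - k) = (-1) ^+ k * e k.
Proof.
move=> lekn; rewrite /poly_of_ecoef coef_sum (bigD1 (inord k)) //= inordK //.
rewrite coefZ coefXn eqxx mulr1 big1 ?addr0 // => i neq_ik.
rewrite coefZ coefXn; case: eqP => [eqn|_]; last by rewrite mulr0.
case/eqP: neq_ik; apply: val_inj; rewrite /= inordK //.
by rewrite -(subKn lekn) eqn subKn // -ltnS.
Qed.

Lemma ecoefK (R : realType) (n : nat) (e : nat -> R[i]) (k : nat) :
  (k <= n)%N -> ecoef n (poly_of_ecoef n e) k = e k.
Proof.
by move=> lekn; rewrite /ecoef coef_poly_of_ecoef // signrMK.
Qed.

Lemma size_poly_of_ecoef (R : realType) (n : nat) (e : nat -> R[i]) :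
  (size (poly_of_ecoef n e) <= n.+1)%N.
Proof.
apply: (leq_trans (size_sum _ _ _)); apply/bigmax_leqP => i _.
by rewrite (leq_trans (size_scale_leq _ _)) // size_polyXn ltnS leq_subr.
Qed.

Lemma poly_of_ecoef_in_P (R : realType) (n : nat) (e : nat -> R[i]) :
  e 0%N = 1 -> in_P n (poly_of_ecoef n e).
Proof.
move=> e0; have cn : (poly_of_ecoef n e)`_n = 1.
  by have := coef_poly_of_ecoef e (leq0n n); rewrite subn0 e0 expr0 mulr1.
have sz : size (poly_of_ecoef n e) = n.+1.
  apply/eqP; rewrite eqn_leq size_poly_of_ecoef ltnNge; apply/negP => le_n.
  by move: cn; rewrite nth_default // => /esym/eqP; rewrite oner_eq0.
by split=> //; rewrite monicE lead_coefE sz /= cn.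
Qed.

Lemma ecoef_expansion (R : realType) (n : nat) (p : {poly R[i]}) :
  in_P n p -> p = \sum_(k < n.+1) 'X^(n - k) * ((-1) ^+ k * ecoef n p k)%:P.
Proof.
move=> [_ sz].
have -> : \sum_(k < n.+1) 'X^(n - k) * ((-1) ^+ k * ecoef n p k)%:P
          = poly_of_ecoef n (ecoef n p).
  by apply: eq_bigr => k _; rewrite mulrC mul_polyC.
apply/polyP => i; have [le_in|lt_ni] := leqP i n; last first.
  by rewrite !nth_default ?sz // (leq_trans (size_poly_of_ecoef _ _)).
by rewrite -(subKn le_in) coef_poly_of_ecoef ?leq_subr // /ecoef signrMK.
Qed.

Lemma ecoef0 (R : realType) (n : nat) (p : {poly R[i]}) :
  in_P n p -> ecoef n p 0 = 1.
Proof.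
by move=> [/monicP + sz]; rewrite /ecoef lead_coefE sz subn0 expr0 mul1r.
Qed.

Lemma fconv_in_P (R : realType) (n : nat) (p q : {poly R[i]}) :
  in_P n p -> in_P n q -> in_P n (fconv n p q).
Proof.
move=> Pp Pq; apply: poly_of_ecoef_in_P.
by rewrite big_ord1 /ffactc !big_ord0 subn0 !ecoef0 // !mul1r invr1.
Qed.

Lemma Qmap_in_P (R : realType) (m : nat) (p : {poly R[i]}) :
  in_P (2 * m) p -> in_P m (Qmap m p).
Proof.
by move=> Pp; apply: poly_of_ecoef_in_P; rewrite muln0 ecoef0 // expr0 mul1r.
Qed.

Lemma rconv_in_P (R : realType) (m : nat) (alpha : R) (p q : {poly R[i]}) :
  in_P m p -> in_P m q -> in_P m (rconv m alpha p q).
Proof.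
move=> Pp Pq; apply: poly_of_ecoef_in_P.
by rewrite big_ord1 /ffactc !big_ord0 subn0 !ecoef0 // !mul1r invr1 mulr1.
Qed.

(* Main.v *)
Require Import Defs.
From mathcomp Require Import all_boot all_order all_algebra.
From mathcomp Require Import reals complex.
From mathcomp Require Import ring.

(** Comparing coefficients, both sides are sums over [i + j = k], where on the
    left only even indices [2 * i], [2 * j] of the sum for [e_(2 * k)] survive:
    an even polynomial of even degree has [e_i = 0] for odd [i]
    ([ecoef_even_odd]).  The weights then agree because grouping the factors
    of a falling factorial two by two gives
    (2a)_(2k) = 4^k (a)_k (a - 1/2)_k  ([ffactc_double]);
    the powers of 4 cancel since [i + j = k], and so do the signs introduced
    by the map Q_m. *)

Import Order.TTheory GRing.Theory Num.Theory.

Local Open Scope ring_scope.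
Local Open Scope complex_scope.

Lemma horner_eq0_poly_eq0 (F : numDomainType) (p : {poly F}) :
  (forall x, p.[x] = 0) -> p = 0.
Proof.
move=> p0; apply: (@roots_geq_poly_eq0 _ p [seq i%:R | i <- iota 0 (size p)]).
- by apply/allP => x _; rewrite /root p0.
- by rewrite map_inj_uniq ?iota_uniq //; apply: mulrIn; rewrite oner_eq0.
- by rewrite size_map size_iota.
Qed.

(** The odd part of [p] vanishes at every [x], since p(-x) = p(x) equates it
    there with its opposite. *)
Lemma even_fun_coef_odd (F : numDomainType) (p : {poly F}) (i : nat) :
  (forall x, p.[- x] = p.[x]) -> odd i -> p`_i = 0.
Proof.
move=> p_even odd_i.
have odd_part0 : (odd_poly p \Po 'X^2) * 'X = 0.
  apply: horner_eq0_poly_eq0 => x; have := p_even x.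
  rewrite -{1 2}(poly_even_odd p) !hornerE !horner_comp !hornerE sqrrN.
  move/addrI/eqP; rewrite mulrN -subr_eq0 -opprD oppr_eq0 -mulr2n.
  by rewrite mulrn_eq0 => /eqP.
have : (odd_poly p)`_i./2 = 0.
  move/eqP: odd_part0; rewrite mulf_eq0 polyX_eq0 orbF => /eqP.
  move/(congr1 (fun q : {poly F} => q`_(i./2 * 2))).
  by rewrite coef_comp_poly_Xn // dvdn_mull // mulnK // coef0.
by rewrite coef_odd_poly; move: (odd_double_half i); rewrite odd_i add1n => ->.
Qed.

Lemma ecoef_even_odd (R : realType) (m : nat) (p : {poly R[i]}) (i : nat) :
  in_PE (2 * m) p -> odd i -> (i <= 2 * m)%N -> ecoef (2 * m) p i = 0.
Proof.
move=> [_ p_even] odd_i le_i; rewrite /ecoef even_fun_coef_odd ?mulr0 //.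
by rewrite oddB // odd_i oddM.
Qed.

Lemma ffactc_double (R : realType) (a : R[i]) (k : nat) :
  ffactc (2 * a) (2 * k) = 4 ^+ k * (ffactc a k * ffactc (a - 1 / 2) k).
Proof.
rewrite /ffactc; elim: k => [|k IH]; first by rewrite !big_ord0 !mulr1.
rewrite mulnS add2n !big_ord_recr /= IH exprS -[(2 * k).+1]addn1 natrD natrM.
by field.
Qed.

Lemma big_ord_even (V : nmodType) (k : nat) (F : nat -> V) :
  (forall i, odd i -> (i < 2 * k)%N -> F i = 0) ->
  \sum_(i < (2 * k).+1) F i = \sum_(i < k.+1) F (2 * i)%N.
Proof.
elim: k => [|k IH] F0; first by rewrite !big_ord1.
rewrite mulnS add2n 2![in LHS]big_ord_recr /= IH => [|i odd_i lt_i].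
  by rewrite [RHS]big_ord_recr /= (F0 (2 * k).+1) ?addr0 ?mulnS //= oddM.
by rewrite F0 // (leq_trans lt_i) // leq_mul.
Qed.

Theorem proposition3p12 (R : realType) (m : nat) (hm : (1 <= m)%N)
    (p q : {poly R[i]}) (hp : in_PE (2 * m) p) (hq : in_PE (2 * m) q) :
  Qmap m (fconv (2 * m) p q) = rconv m (- (1 / 2)) (Qmap m p) (Qmap m q).
Proof.
(* Both sides unfold to [poly_of_ecoef m], so e_k is compared for each k. *)
apply: eq_bigr => -[k lt_k] _ /=; congr ((_ * _) *: _).
have le_k : (k <= m)%N by [].
have dbl j : ffactc (2 * m)%:R (2 * j)
    = 4 ^+ j * (ffactc m%:R j * ffactc (m%:R + (- (1 / 2) : R)%:C) j).
  by rewrite natrM ffactc_double rmorphN rmorphM fmorphV rmorph1 rmorph_nat.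
rewrite ecoefK ?leq_mul // (big_ord_even _ _ (fun i =>
  ecoef (2 * m) p i * ecoef (2 * m) q (2 * k - i) /
  (ffactc (2 * m)%:R i * ffactc (2 * m)%:R (2 * k - i)))) => [|i odd_i lt_i]; last first.
  by rewrite ecoef_even_odd ?mul0r // (leq_trans (ltnW lt_i)) ?leq_mul.
rewrite dbl !mulr_sumr; apply: eq_bigr => -[i lt_ik] _ /=.
have le_ik : (i <= k)%N by [].
rewrite !ecoefK ?(leq_trans le_ik) ?(leq_trans (leq_subr _ _)) //.
rewrite -mulnBr !dbl -{1 2}(subnKC le_ik) !exprD !invfM.
have four_neq0 j : (4 ^+ j : R[i]) != 0 by rewrite expf_neq0 ?pnatr_eq0.
(* The inverses of the falling factorials enter as opaque scalars, so that
   only the powers of 4 have to be nonzero. *)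
move: (ffactc m%:R i)^-1 (ffactc (_ + _) i)^-1 => Ai Bi.
move: (ffactc m%:R (k - i))^-1 (ffactc (_ + _) (k - i))^-1 => Aj Bj.
by field; rewrite !four_neq0.
Qed.
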